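(* Let $k$ be a difference field of characteristic $0$, $R=k\{y_1,\ldots,y_n\}$, $I$ a radical well-mixed monomial $\sigma$-ideal of $R$, and $\mathbf{a}\in(\mathbb{N}\cup\{-1\})^n$ with $\mathbf{a}\geqslant\mathbf{b}$ for every character vector $\mathbf{b}$ of $I$. Then \[I=\bigcap\{\mathfrak{m}^{\mathbf{a}\backslash\mathbf{b}}:\mathbf{b}\text{ is a character vector of }I^{[\mathbf{a}]}\},\] and \[I^{[\mathbf{a}]}=\langle \mathbf{y}^{x^{\mathbf{a}\backslash\mathbf{b}}}:\mathfrak{m}^{\mathbf{b}}\text{ is an irreducible component of }I\rangle_r.\]
   Context: A difference field is a field $k$ with a ring endomorphism $\sigma$; $R=k\{y_1,\ldots,y_n\}$ is the polynomial ring over $k$ in the variables $\sigma^j(y_i)$, with $\sigma$ extended naturally. For $p=\sum_i c_ix^i\in\mathbb{N}[x]$ and $a\in R$, $a^p=\prod_i(\sigma^i(a))^{c_i}$; $\mathbf{y}^{\mathbf{u}}=y_1^{u_1}\cdots y_n^{u_n}$. A $\sigma$-ideal is an ideal stable under $\sigma$; monomial if generated by monomials; well-mixed if $ab\in I\Rightarrow a\sigma(b)\in I$. $\langle F\rangle_r$ is the smallest radical well-mixed $\sigma$-ideal containing $F$. For $\mathbf{b}\in(\mathbb{N}\cup\{-1\})^n$, $x^{\mathbf{b}}=(x^{b_1},\ldots,x^{b_n})$ with $x^{-1}=0$, and $\mathfrak{m}^{\mathbf{b}}$ is the $\sigma$-ideal generated by $\{y_i^{x^{b_i}}:b_i\ne-1\}$.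 Every radical well-mixed monomial $\sigma$-ideal $I$ has a unique irredundant decomposition $I=\mathfrak{m}^{\mathbf{b}_1}\cap\cdots\cap\mathfrak{m}^{\mathbf{b}_s}$; the $\mathfrak{m}^{\mathbf{b}_i}$ are its irreducible components. Vectors are compared componentwise. The character vectors of $I$ are the finitely many vectors $\mathbf{a}_1,\ldots,\mathbf{a}_m$ forming a minimal set with $I=\langle\mathbf{y}^{x^{\mathbf{a}_1}},\ldots,\mathbf{y}^{x^{\mathbf{a}_m}}\rangle_r$ (equivalently, the componentwise-minimal $\mathbf{a}$ with $\mathbf{y}^{x^{\mathbf{a}}}\in I$). For $\mathbf{b}\leqslant\mathbf{a}$, $\mathbf{a}\backslash\mathbf{b}$ has $i$-th coordinate $a_i+1-b_i$ if $b_i\ge0$ and $-1$ if $b_i=-1$. The Alexander dual is $I^{[\mathbf{a}]}=\bigcap\{\mathfrak{m}^{\mathbf{a}\backslash\mathbf{b}}:\mathbf{b}\text{ a character vector of }I\}$, defined when $\mathbf{a}$ dominates all character vectors of $I$. *)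

(* Defs.v *)
From HB Require Import structures.
From mathcomp Require Import all_boot all_order all_algebra.
From mathcomp Require Import finmap.
From mathcomp.multinomials Require Import monalg.
Set Implicit Arguments. Unset Strict Implicit. Unset Printing Implicit Defensive.
Import Order.TTheory GRing.Theory Num.Theory.
Local Open Scope ring_scope.

(* Variables of R = k{y_1..y_n}: the pair (j, i) stands for sigma^j(y_i). *)
Definition dvar (n : nat) := (nat * 'I_n)%type.

Definition dpoly (k : fieldType) (n : nat) := {malg k[cmonom (dvar n)]}.

Section Diff.
Variables (k : fieldType) (sig : {rmorphism k -> k}) (n : nat).
Local Notation R := (dpoly k n).

Definition dY (j : nat) (i : 'I_n) : R := << ucm ((j, i) : dvar n) >>.

Definition shiftm (m : cmonom (dvar n)) : cmonom (dvar n) :=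
  \big[mmul/mone]_(x <- finsupp m) expcmn (ucm ((x.1.+1, x.2) : dvar n)) (m x).

Definition sigmaR (p : R) : R :=
  \sum_(m <- msupp p) << sig p@_m *g shiftm m >>.

Definition subR (A B : R -> Prop) := forall x, A x -> B x.
Definition eqR (A B : R -> Prop) := forall x, A x <-> B x.

Definition is_ideal (I : R -> Prop) :=
  [/\ I 0, (forall a b, I a -> I b -> I (a + b)) & (forall r a, I a -> I (r * a))].
Definition sigma_stable (I : R -> Prop) := forall a, I a -> I (sigmaR a).
Definition is_sigma_ideal (I : R -> Prop) := is_ideal I /\ sigma_stable I.
Definition is_radical (I : R -> Prop) := forall a m, I (a ^+ m) -> I a.
Definition well_mixed (I : R -> Prop) := forall a b, I (a * b) -> I (a * sigmaR b).

Definition ideal_gen (F : R -> Prop) : R -> Prop :=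
  fun x => forall J, is_ideal J -> subR F J -> J x.
Definition sigma_ideal_gen (F : R -> Prop) : R -> Prop :=
  fun x => forall J, is_sigma_ideal J -> subR F J -> J x.
Definition rwm_closure (F : R -> Prop) : R -> Prop :=
  fun x => forall J, is_sigma_ideal J -> is_radical J -> well_mixed J ->
                     subR F J -> J x.

Definition is_monomial_ideal (I : R -> Prop) :=
  is_ideal I /\ eqR I (ideal_gen (fun p => I p /\ exists m, p = << m >>)).

(* vectors in (N u {-1})^n, encoded as int-valued finite functions *)
Definition evec := {ffun 'I_n -> int}.
Definition valid (a : evec) := forall i, (-1 <= a i)%R.
Definition vle (a b : evec) := forall i, (a i <= b i)%R.

Definition ymon (a : evec) : R :=
  \prod_(i < n | (0 <= a i)%R) dY `|a i|%N i.

Definition mideal (b : evec) : R -> Prop :=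
  sigma_ideal_gen (fun p => exists2 i, (0 <= b i)%R & p = dY `|b i|%N i).

Definition charvec (I : R -> Prop) (b : evec) :=
  [/\ valid b, I (ymon b) &
      forall c, valid c -> vle c b -> I (ymon c) -> c = b].

Definition adiff (a b : evec) : evec :=
  [ffun i => if (0 <= b i)%R then a i + 1 - b i else -1].

Definition alex_dual (I : R -> Prop) (a : evec) : R -> Prop :=
  fun x => forall b, charvec I b -> mideal (adiff a b) x.

Definition mcap (bs : seq evec) : R -> Prop :=
  fun x => forall c, c \in bs -> mideal c x.

Definition irr_component (I : R -> Prop) (b : evec) :=
  exists bs : seq evec,
    [/\ (forall c, c \in bs -> valid c), uniq bs, eqR I (mcap bs),
        (forall c, c \in bs -> ~ eqR I (mcap (rem c bs))) & b \in bs].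
End Diff.

(* Main.v *)
Require Import Defs.
From HB Require Import structures.
From mathcomp Require Import all_boot all_order all_algebra.
From mathcomp Require Import finmap boolp zify.
From mathcomp.multinomials Require Import monalg.
Import Order.TTheory GRing.Theory Num.Theory.
Local Open Scope ring_scope.
Set Implicit Arguments.
Unset Strict Implicit.

(** A radical well-mixed sigma-ideal contains a monomial [m] iff it contains
    [y^(x^c)], where [c_i] is the largest order of [y_i] in [m]: well-mixedness
    raises each factor [sigma^j(y_i)] to [sigma^(c_i)(y_i)], and radicality
    discards multiplicities. So a monomial [I] is the up-set of the vectors [c]
    with [y^(x^c)] in [I], and [y^(x^c)] lies in [m^b] iff [0 <= b_i <= c_i] for
    some [i]. Since [c_i < b_i] iff [a_i - c_i >= a_i + 1 - b_i], reflecting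
    [c] in [a] exchanges the complement of the up-set of [I] with the up-set of
    the dual, which gives both equalities. The ideals [m^b] are prime, as they
    are generated by variables, so that the dual is radical and well-mixed. *)

(** * Weights separating monomials *)

Lemma exists_nonroot_nat (p : {poly int}) :
  p != 0 -> exists B : nat, p.[B%:R] != 0.
Proof.
move=> p0; case: (boolP (has (fun B : nat => p.[B%:R] != 0) (iota 0 (size p)))).
  by case/hasP => B _ hB; exists B.
(* Otherwise all [size p] naturals below [size p] are roots, too many for a nonzero polynomial. *)
move/hasPn => h; suff: (size p < size p)%N by rewrite ltnn.
rewrite -{1}(size_iota 0 (size p)) -(size_map (fun B : nat => B%:R : int)).
apply: max_poly_roots => //.
  by apply/allP => _ /mapP [B /h /negPn hB ->].
by rewrite map_inj_uniq ?iota_uniq // => x y /eqP; rewrite eqr_nat => /eqP.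
Qed.

Section Weight.
Variables (T : countType) (B : nat).

(** The exponent of [m] under the Kronecker substitution of ['X^(B ^ pickle x)] for [x]. *)
Definition weight (m : cmonom T) : nat :=
  (\sum_(x <- finsupp m) m x * B ^ choice.pickle x)%N.

Lemma weightEw (S : {fset T}) (m : cmonom T) : (finsupp m `<=` S)%fset ->
  weight m = (\sum_(x <- S) m x * B ^ choice.pickle x)%N.
Proof.
move=> sub; rewrite /weight; apply: big_fset_incl => // x _.
by rewrite -cmE_eq0 => /eqP ->; rewrite mul0n.
Qed.

Lemma weight1 : weight mone = 0%N.
Proof. by rewrite /weight mdom1 big_nil. Qed.

Lemma weightM m1 m2 : weight (mmul m1 m2) = (weight m1 + weight m2)%N.
Proof.
rewrite (@weightEw (finsupp m1 `|` finsupp m2)%fset); last by rewrite mdomD.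
rewrite (@weightEw (finsupp m1 `|` finsupp m2)%fset m1) ?fsubsetUl //.
rewrite (@weightEw (finsupp m1 `|` finsupp m2)%fset m2) ?fsubsetUr //.
by rewrite -big_split; apply: eq_bigr => x _ /=; rewrite cmM mulnDl.
Qed.

End Weight.

(* Two distinct monomials have the same weight only if [B] is a root of a
   nonzero integer polynomial attached to them. *)
Lemma exists_separating_weight (T : countType) (S : seq (cmonom T)) :
  exists B, {in S &, injective (@weight T B)}.
Proof.
pose P (m1 m2 : cmonom T) : {poly int} :=
  \sum_(x <- (finsupp m1 `|` finsupp m2)%fset) 
      ((m1 x)%:R - (m2 x)%:R) *: 'X^(choice.pickle x).
have PE m1 m2 B : (P m1 m2).[B%:R] = (weight B m1)%:R - (weight B m2)%:R.
  rewrite (@weightEw _ B (finsupp m1 `|` finsupp m2)%fset m1) ?fsubsetUl //.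
  rewrite (@weightEw _ B (finsupp m1 `|` finsupp m2)%fset m2) ?fsubsetUr //.
  rewrite horner_sum !natr_sum -sumrB; apply: eq_bigr => x _.
  by rewrite hornerZ hornerXn mulrBl !natrM natrX.
have P0 m1 m2 : m1 != m2 -> P m1 m2 != 0.
  apply: contraNneq => P0; apply/cmP => x.
  case: (boolP (x \in (finsupp m1 `|` finsupp m2)%fset)) => hx; last first.
    by move: hx; rewrite in_fsetU negb_or -!cmE_eq0 => /andP [/eqP -> /eqP ->].
  have := congr1 (fun p : {poly int} => p`_(choice.pickle x)) P0; rewrite coef0 coef_sum.
  rewrite (big_fsetD1 x) //= coefZ coefXn eqxx mulr1 big1_seq ?addr0.
    by move/eqP; rewrite subr_eq0 eqr_nat => /eqP.
  move=> y /andP [_]; rewrite !inE => /andP [yx _].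
  rewrite coefZ coefXn (inj_eq (pcan_inj (@choice.pickleK T))) eq_sym.
  by rewrite (negbTE yx) mulr0.
(* A nonroot of this product separates all pairs of [S] at once. *)
have : \prod_(m1 <- S) \prod_(m2 <- S | m1 != m2) P m1 m2 != 0.
  rewrite prodf_seq_neq0; apply/allP => m1 _ /=.
  rewrite prodf_seq_neq0; apply/allP => m2 _; apply/implyP; exact: P0.
case/exists_nonroot_nat => B.
rewrite horner_prod prodf_seq_neq0 => /allP h; exists B => m1 m2 /h /= + h2 e.
rewrite horner_prod prodf_seq_neq0 => /allP /(_ _ h2) /=.
by rewrite PE e subrr eqxx implybF negbK => /eqP.
Qed.

(** * Ideals generated by variables *)

Section VariableIdeal.
Variables (k : fieldType) (T : countType) (V : pred T).
Local Notation R := {malg k[cmonom T]}.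

Definition hits (m : cmonom T) := has V (finsupp m).

(** The ideal generated by the variables in [V], encoded by its membership test on monomials. *)
Definition varideal (p : R) := all hits (msupp p).

Lemma hitsM m1 m2 : hits (mmul m1 m2) = hits m1 || hits m2.
Proof.
rewrite /hits mdomD; apply/hasP/orP => [[x]|].
  by rewrite inE => /orP [xm Vx | xm Vx]; [left | right]; apply/hasP; exists x.
by case=> /hasP [x xm Vx]; exists x; rewrite // inE xm ?orbT.
Qed.

(** Reduction modulo the variables in [V], followed by the Kronecker substitution. *)
Definition weight_poly (B : nat) (m : cmonom T) : {poly k} :=
  if hits m then 0 else 'X^(weight B m).

Lemma weight_poly_mmorphism B : mmorphism (weight_poly B).
Proof.
split=> [m1 m2|]; last by rewrite /weight_poly /hits mdom1 weight1.
rewrite /weight_poly hitsM weightM exprD.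
by case: (hits m1); case: (hits m2); rewrite ?mul0r ?mulr0.
Qed.

HB.instance Definition _ B :=
  isMultiplicative.Build (cmonom T) {poly k} (weight_poly B)
    (weight_poly_mmorphism B).

(** Monomials of [p] free of [V] go to distinct powers of ['X], so their coefficients survive. *)
Lemma mmap_weight_poly_eq0 B (p : R) :
  {in msupp p &, injective (@weight T B)} ->
  mmap polyC (weight_poly B) p = 0 <-> varideal p.
Proof.
move=> injB; split=> [p0|/allP h]; last first.
  by rewrite /mmap big1_seq // => m /andP [_ /h hm]; rewrite /weight_poly hm mulr0.
apply/allP => m mp; apply: contraT => hm.
have := congr1 (fun q : {poly k} => q`_(weight B m)) p0; rewrite coef0 coef_sum.
rewrite (big_fsetD1 m) //= {1}/weight_poly (negbTE hm) coefCM coefXn eqxx mulr1.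
rewrite big1_seq ?addr0.
  by move=> /eqP; rewrite mcoeff_eq0 mp.
move=> m' /andP [_]; rewrite !inE => /andP [nm m'p].
rewrite coefCM /weight_poly; case: (hits m'); rewrite ?coef0 ?mulr0 // coefXn.
case: eqP => [/injB e|]; last by rewrite mulr0.
by rewrite (e mp m'p) eqxx in nm.
Qed.

(* A weight separating the monomials of [p], [q] and [p * q] maps them to
   {poly k}, a domain, without cancellation. *)
Lemma varideal_prime (p q : R) : varideal (p * q) -> varideal p || varideal q.
Proof.
case: (@exists_separating_weight T (msupp p ++ msupp q ++ msupp (p * q))) => B injB.
have sub (r : R) : {subset msupp r <= msupp p ++ msupp q ++ msupp (p * q)} ->
    mmap polyC (weight_poly B) r = 0 <-> varideal r.
  move=> sr; apply: mmap_weight_poly_eq0 => m1 m2 /sr h1 /sr h2; exact: injB.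
have /sub hp : {subset msupp p <= msupp p ++ msupp q ++ msupp (p * q)}.
  by move=> m mp; rewrite mem_cat mp.
have /sub hq : {subset msupp q <= msupp p ++ msupp q ++ msupp (p * q)}.
  by move=> m mq; rewrite !mem_cat mq orbT.
have /sub hpq : {subset msupp (p * q) <= msupp p ++ msupp q ++ msupp (p * q)}.
  by move=> m mpq; rewrite !mem_cat mpq !orbT.
move/hpq/eqP; rewrite rmorphM mulf_eq0.
by case/orP => /eqP => [/hp | /hq] ->; rewrite ?orbT.
Qed.

Lemma varideal_mull (p q : R) : varideal q -> varideal (p * q).
Proof.
move=> /allP hq; apply/allP => m /msuppM_le [m1 [m2 [_ /hq h ->]]].
by rewrite hitsM h orbT.
Qed.

Lemma varidealM (p q : R) : varideal (p * q) = varideal p || varideal q.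
Proof.
apply/idP/orP => [/varideal_prime/orP //|[h|h]]; last exact: varideal_mull.
by rewrite mulrC varideal_mull.
Qed.

Lemma varideal1 : varideal 1 = false.
Proof.
rewrite /varideal msuppU1 /hits; apply/negbTE/allPn.
by exists mone; rewrite ?inE // mdom1.
Qed.

Lemma varideal0 : varideal 0.
Proof. by rewrite /varideal msupp0. Qed.

Lemma varidealD (p q : R) : varideal p -> varideal q -> varideal (p + q).
Proof.
move=> /allP hp /allP hq; apply/allP => m /(fsubsetP (msuppD_le p q)).
by rewrite inE => /orP [/hp|/hq].
Qed.

Lemma varidealX (p : R) N : varideal (p ^+ N) -> varideal p.
Proof.
by elim: N => [|N IH]; rewrite ?expr0 ?varideal1 // exprS varidealM => /orP [].
Qed.

Lemma varidealU m : varideal << m >> = hits m.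
Proof.
rewrite /varideal msuppU1.
by apply/allP/idP => [->|h x]; rewrite ?inE // => /eqP ->.
Qed.

End VariableIdeal.

Section MonomialExtra.
Variables (k : fieldType) (T : choiceType).
Implicit Types (m : cmonom T) (x : T).

Lemma malgUM (c : k) m1 m2 :
  << c *g mmul m1 m2 >> = << c *g m2 >> * << m1 >> :> {malg k[cmonom T]}.
Proof. by rewrite malgM_def fgmulUU mulr1 mulmC. Qed.

Lemma mdom_factor m x : x \in finsupp m ->
  m = mmul (ucm x) (divcm m (ucm x)).
Proof.
move=> xm; apply/eqP/cmP => y; rewrite cmM divcmE cmU.
case: eqP => [<-|_]; last by rewrite subn0.
by rewrite addnC subnK // lt0n cmE_neq0.
Qed.

Lemma mdom_expcmn x N : finsupp (expcmn (ucm x) N.+1) = [fset x]%fset.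
Proof.
elim: N => [|N IH]; first by rewrite mdomU.
rewrite (_ : expcmn _ _ = mmul (ucm x) (expcmn (ucm x) N.+1)) //.
by rewrite mdomD IH mdomU fsetUid.
Qed.

End MonomialExtra.

(** * The shift of variables and the ideals [m^b] *)

Section Difference.
Variables (k : fieldType) (sig : {rmorphism k -> k}) (n : nat).
Local Notation R := (dpoly k n).
Implicit Types (m : cmonom (dvar n)) (I : R -> Prop) (b e : evec n).

Lemma shiftmU (x : dvar n) : shiftm (ucm x) = ucm ((x.1.+1, x.2) : dvar n).
Proof. by rewrite /shiftm mdomU big_seq_fset1 cmUU. Qed.

Lemma mdom_shiftm m (x : dvar n) : x \in finsupp m ->
  ((x.1.+1, x.2) : dvar n) \in finsupp (shiftm m).
Proof.
move=> xm; rewrite /shiftm (big_fsetD1 x) //= mdomD inE.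
have: m x != 0%N by rewrite cmE_neq0.
by case: (m x) => // N _; rewrite mdom_expcmn inE eqxx.
Qed.

Lemma sigmaR_dY j (i : 'I_n) : sigmaR sig (dY k j i) = dY k j.+1 i.
Proof.
by rewrite /sigmaR /dY msuppU1 big_seq_fset1 mcoeffUU rmorph1 shiftmU.
Qed.

(** The variables lying in [m^b]: its generators and their transforms. *)
Definition above b : pred (dvar n) := fun x => 0 <= b x.2 <= x.1%:Z.

Lemma varideal_sigmaR b (p : R) :
  varideal (above b) p -> varideal (above b) (sigmaR sig p).
Proof.
move=> /allP hp; rewrite /sigmaR big_seq.
apply: (big_ind (fun q : R => varideal (above b) q)).
- exact: varideal0.
- by move=> q r; apply: varidealD.
move=> m /hp /hasP [x xm /andP [b0 bx]]; apply/allP => m'.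
move/(fsubsetP msuppU_le); rewrite inE => /eqP ->.
apply/hasP; exists ((x.1.+1, x.2) : dvar n); first exact: mdom_shiftm.
by rewrite /above b0 /=; apply: le_trans bx _; rewrite lez_nat.
Qed.

Lemma sigma_ideal_dY I j j' (i : 'I_n) : sigma_stable sig I ->
  (j <= j')%N -> I (dY k j i) -> I (dY k j' i).
Proof.
move=> sI jj' h; rewrite -(subnK jj').
elim: (j' - j)%N => [|d IH]; first by rewrite add0n; exact: h.
by rewrite addSn -sigmaR_dY; exact: sI IH.
Qed.

(** The right side is a sigma-ideal containing the generators; conversely, iterating [sigma] on the
    generators reaches every variable of [above b]. *)
Lemma mideal_varideal b (p : R) : mideal sig b p <-> varideal (above b) p.
Proof.
split=> [|/allP hp].
  move=> h; apply: (h (fun q : R => varideal (above b) q)).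
    split; last by move=> q; exact: varideal_sigmaR.
    split=> [|q r|q r]; [exact: varideal0 | exact: varidealD |].
    exact: varideal_mull.
  move=> _ [i b0 ->]; rewrite varidealU /hits mdomU.
  apply/hasP; exists (`|b i|%N, i); first by rewrite inE.
  by rewrite /above b0 /= gez0_abs.
move=> J [[J0 JD JM] sJ] gJ; rewrite (monalgE p) big_seq.
apply: (big_ind J) => // m mp; have /hasP [[j i] xm /andP [/= b0 bx]] := hp m mp.
rewrite (mdom_factor xm) malgUM; apply: JM.
apply: (@sigma_ideal_dY _ `|b i|%N) => //; first by rewrite -lez_nat gez0_abs.
by apply: gJ; exists i.
Qed.

End Difference.

(** Positivity excludes the default value [0] of an empty maximum. *)
Lemma bigmax_seq_attained (T : eqType) (s : seq T) (P : pred T) (F : T -> nat) :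
  (0 < \max_(x <- s | P x) F x)%N ->
  exists x, [/\ x \in s, P x & F x = \max_(x <- s | P x) F x].
Proof.
elim: s => [|y s IH]; first by rewrite big_nil.
rewrite big_cons; case Py: (P y) => h; last first.
  by case: (IH h) => x [xs Px e]; exists x; rewrite inE xs orbT.
have [le|lt] := leqP (\max_(x <- s | P x) F x) (F y).
  by exists y; rewrite mem_head; split=> //; rewrite (maxn_idPl le).
have [x [xs Px e]] := IH (leq_ltn_trans (leq0n _) lt).
by exists x; rewrite inE xs orbT; split=> //; rewrite e (maxn_idPr (ltnW lt)).
Qed.

(** * Monomials in radical well-mixed ideals *)

Section MaxOrder.
Variable n : nat.
Implicit Types (m : cmonom (dvar n)).

(* The entry at [i] is -1 when no transform of [y_i] occurs in [m]. *)
Definition mvec m : evec n :=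
  [ffun i => (\max_(x <- finsupp m | x.2 == i) x.1.+1)%:Z - 1].

Lemma mvec_valid m : valid (mvec m).
Proof. by move=> i; rewrite ffunE; lia. Qed.

Lemma mvec_ge m (x : dvar n) : x \in finsupp m -> x.1%:Z <= mvec m x.2.
Proof.
move=> xm; rewrite ffunE.
have := @leq_bigmax_seq (dvar n) (enum_fset (finsupp m)) (fun y : dvar n => y.2 == x.2)
  (fun y => y.1.+1) x xm (eqxx _).
rewrite /=; move: (\max_(_ <- _ | _) _)%N => N; lia.
Qed.

Lemma mvec_attained m i : 0 <= mvec m i ->
  exists2 j, (j, i) \in finsupp m & mvec m i = j%:Z.
Proof.
rewrite ffunE => h.
have : (0 < \max_(x <- finsupp m | x.2 == i) x.1.+1)%N.
  by move: h; move: (\max_(_ <- _ | _) _)%N => N; lia.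
case/bigmax_seq_attained => -[j i'] [xm /= /eqP e <-].
by subst i'; exists j => //; lia.
Qed.

End MaxOrder.

(** * Replacing the factors of a monomial *)

Section Divisors.
Variables (k : fieldType) (n : nat).
Local Notation R := (dpoly k n).

Lemma dY_dvd_ymon (e : evec n) i : 0 <= e i ->
  exists r : R, ymon k e = r * dY k `|e i|%N i.
Proof.
move=> e0; exists (\prod_(j < n | (0 <= e j) && (j != i)) dY k `|e j|%N j).
by rewrite mulrC /ymon (bigD1 i).
Qed.

Lemma dY_dvd_monomial (m : cmonom (dvar n)) (x : dvar n) : x \in finsupp m ->
  exists r : R, << m >> = r * dY k x.1 x.2.
Proof.
move=> xm; exists << divcm m (ucm x) >>.
by rewrite {1}(mdom_factor xm) malgUM /dY -surjective_pairing.
Qed.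
End Divisors.

Section Replaceable.
Variables (A : comPzRingType) (I : A -> Prop).
Implicit Types u q c : A.

(** The cofactor [c] makes the relation multiplicative, so that a monomial can be replaced factor by
    factor. *)
Definition replaceable u q := forall c, I (u * c) -> I (q * c).

Lemma replaceable1 : replaceable 1 1.
Proof. by []. Qed.

Lemma replaceableM u1 u2 q1 q2 :
  replaceable u1 q1 -> replaceable u2 q2 -> replaceable (u1 * u2) (q1 * q2).
Proof.
move=> h1 h2 c; rewrite -mulrA => /h1; rewrite mulrCA => /h2.
by rewrite mulrCA mulrA.
Qed.

Lemma replaceable_id u q : replaceable u q -> I u -> I q.
Proof. by move=> h; rewrite -{1}[u]mulr1 -{1}[q]mulr1; apply: h. Qed.

End Replaceable.

Section Replacement.
Variables (k : fieldType) (sig : {rmorphism k -> k}) (n : nat).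
Local Notation R := (dpoly k n).
Variable I : R -> Prop.
Hypotheses (idI : is_sigma_ideal sig I) (radI : is_radical I).
Hypothesis (wmI : well_mixed sig I).
Implicit Types (m : cmonom (dvar n)) (e : evec n) (p q u c : R).

Lemma replaceable_radical u q N : replaceable I u (q ^+ N) -> I u -> I q.
Proof. by move=> h Iu; apply: radI (replaceable_id h Iu). Qed.

(** Well-mixedness is applied [j' - j] times, with the transform of [y_i] as second factor. *)
Lemma replaceable_dY j j' (i : 'I_n) r :
  (j <= j')%N -> replaceable I (dY k j i) (r * dY k j' i).
Proof.
move=> jj' c h; rewrite -mulrA; case: idI => [[_ _ IM] _]; apply: IM.
rewrite -(subnK jj'); elim: (j' - j)%N => [|d IH]; first by rewrite add0n.
by rewrite addSn -(sigmaR_dY sig) mulrC; apply: wmI; rewrite mulrC.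
Qed.

(** Every factor, counted with multiplicity, becomes the same [q]; radicality later removes the
    exponent. *)
Lemma replaceable_monomial m q :
  (forall x, x \in finsupp m -> replaceable I (dY k x.1 x.2) q) ->
  replaceable I << m >> (q ^+ mdeg m).
Proof.
move: {2}(mdeg m) (erefl (mdeg m)) => d.
elim: d m => [|d IH] m md hq.
  by rewrite md (mdeg_eq0I md) expr0; apply: replaceable1.
have [m0|[x xm]] := fset_0Vmem (finsupp m).
  by move: md; rewrite mdegE m0 big_seq_fset0.
have md' : mdeg (divcm m (ucm x)) = d.
  by move: md; rewrite {1}(mdom_factor xm) mdegM mdegU => -[].
rewrite md exprSr {1}(mdom_factor xm) malgUM -md'; apply: replaceableM.
  apply: IH => // y ym; apply: hq; move: ym.
  by rewrite -!cmE_neq0 divcmE -!lt0n => /leq_trans -> //; rewrite leq_subr.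
by rewrite [x]surjective_pairing; apply: hq.
Qed.

Lemma replaceable_ymon e q :
  (forall i, 0 <= e i -> replaceable I (dY k `|e i|%N i) q) ->
  exists N, replaceable I (ymon k e) (q ^+ N).
Proof.
move=> hq; apply: (big_ind (fun u => exists N, replaceable I u (q ^+ N))).
- by exists 0%N; rewrite expr0; apply: replaceable1.
- move=> u v [N1 h1] [N2 h2]; exists (N1 + N2)%N; rewrite exprD.
  exact: replaceableM.
- by move=> i e0; exists 1%N; rewrite expr1; apply: hq.
Qed.

(** Each factor of [ymon k e] is raised to a divisor of [ymon k e'] and then replaced by all of
    [ymon k e']. Entries -1 give no factor, hence no condition. *)
Lemma ymon_le e e' : (forall i, 0 <= e i -> e i <= e' i) ->
  I (ymon k e) -> I (ymon k e').
Proof.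
move=> ee'; have [|N h] := @replaceable_ymon e (ymon k e'); last first.
  exact: replaceable_radical h.
move=> i e0; have le := ee' i e0; have [r ->] := dY_dvd_ymon k (le_trans e0 le).
by apply: replaceable_dY; lia.
Qed.

Lemma monomial_ymon m e : (forall x, x \in finsupp m -> x.1%:Z <= e x.2) ->
  I << m >> -> I (ymon k e).
Proof.
move=> h; apply: replaceable_radical (replaceable_monomial _) => x xm.
have le := h x xm; have [|r ->] := @dY_dvd_ymon k _ e x.2; first lia.
by apply: replaceable_dY; lia.
Qed.

Lemma ymon_monomial m e :
  (forall i, 0 <= e i -> exists2 j, (j, i) \in finsupp m & e i <= j%:Z) ->
  I (ymon k e) -> I << m >>.
Proof.
move=> h; have [|N hN] := @replaceable_ymon e << m >>; last first.
  exact: replaceable_radical hN.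
move=> i e0; have [j xm le] := h i e0; have [r ->] := dY_dvd_monomial k xm.
by apply: replaceable_dY => /=; lia.
Qed.

Lemma monomialE m : I << m >> <-> I (ymon k (mvec m)).
Proof.
split; first by apply: monomial_ymon => x; apply: mvec_ge.
by apply: ymon_monomial => i /mvec_attained [j jm ->]; exists j.
Qed.

End Replacement.

(** * Monomial ideals and membership in [m^b] *)

Section Monomials.
Variables (k : fieldType) (n : nat).
Local Notation R := (dpoly k n).

Lemma monomial_idealE (I : R -> Prop) : is_monomial_ideal I ->
  forall p, I p <-> forall m, m \in msupp p -> I << m >>.
Proof.
move=> [[I0 ID IM] genI] p; split=> [/genI Jp|h]; last first.
  rewrite (monalgE p) big_seq; apply: (big_ind I) => [||m /h hm].
  - exact: I0.
  - exact: ID.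
  by rewrite -[X in << _ *g X >>]mulm1 malgUM; exact: IM hm.
(* Polynomials with all their monomials in [I] form an ideal containing the generators. *)
apply: (Jp (fun q : R => forall m, m \in msupp q -> I << m >>)).
  split=> [m|q r hq hr m|q r hr m].
  - by rewrite msupp0.
  - by move/(fsubsetP (msuppD_le q r)); rewrite inE => /orP [/hq|/hr].
  move/msuppM_le => [m1 [m2 [_ /hr h ->]]].
  by rewrite mulmC malgUM; apply: IM.
move=> q [Iq [m e]] m'.
rewrite e msuppU1 => /fset1P ->.
by rewrite -e; exact: Iq.
Qed.

End Monomials.

Section Irreducible.
Variables (k : fieldType) (sig : {rmorphism k -> k}) (n : nat).
Local Notation R := (dpoly k n).
Implicit Types (b e : evec n) (p : R).

Lemma mideal_sigma_ideal b : is_sigma_ideal sig (mideal sig b).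
Proof.
split; first split.
- exact/mideal_varideal/varideal0.
- by move=> p q /mideal_varideal ? /mideal_varideal ?; apply/mideal_varideal/varidealD.
- by move=> p q /mideal_varideal ?; apply/mideal_varideal/varideal_mull.
- by move=> p /mideal_varideal ?; apply/mideal_varideal/varideal_sigmaR.
Qed.

Lemma mideal_radical b : is_radical (mideal sig b).
Proof. by move=> p m /mideal_varideal /varidealX ?; apply/mideal_varideal. Qed.

(** By primality one factor lies in [m^b]; if it is the second, so does its image under [sigma]. *)
Lemma mideal_well_mixed b : well_mixed sig (mideal sig b).
Proof.
move=> p q /mideal_varideal; rewrite varidealM => h; apply/mideal_varideal.
rewrite varidealM; case/orP: h => [-> //|/varideal_sigmaR ->]; exact: orbT.
Qed.

Lemma mideal_ymon b e :
  mideal sig b (ymon k e) <-> exists i, 0 <= b i <= e i.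
Proof.
have hY i : 0 <= e i -> above b (`|e i|%N, i) = (0 <= b i <= e i).
  by move=> e0; rewrite /above /= gez0_abs.
rewrite mideal_varideal /ymon (big_morph _ (@varidealM _ _ _) (varideal1 _ _)).
rewrite big_has_cond; split.
  case/hasP => i _ /andP [e0]; rewrite varidealU /hits mdomU => /hasP [x].
  by rewrite inE => /eqP ->; rewrite hY // => h; exists i.
case=> i h; have e0 : 0 <= e i by case/andP: h; apply: le_trans.
apply/hasP; exists i; first exact: mem_index_enum.
rewrite /= e0 varidealU /hits mdomU /=.
by apply/hasP; exists (`|e i|%N, i); rewrite ?inE // hY.
Qed.

Lemma midealE b p :
  mideal sig b p <-> forall m, m \in msupp p -> exists i, 0 <= b i <= mvec m i.
Proof.
split=> [/mideal_varideal /allP h m mp|h].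
  apply/mideal_ymon; apply/monomialE;
    [exact: mideal_sigma_ideal|exact: mideal_radical|exact: mideal_well_mixed|].
  by apply/mideal_varideal; rewrite varidealU h.
apply/mideal_varideal/allP => m /h [i /andP [b0 bi]].
have [j jm e] := mvec_attained (le_trans b0 bi).
by apply/hasP; exists (j, i); rewrite // /above /= b0 -e.
Qed.

End Irreducible.

(** * Alexander duality *)

Section Vectors.
Variable n : nat.
Implicit Types (a b c d e : evec n).

Lemma exists_minimal_vec (U : evec n -> Prop) c : valid c -> U c ->
  exists d, [/\ valid d, U d, vle d c &
    forall e, valid e -> vle e d -> U e -> e = d].
Proof.
(* On valid vectors each [c i + 1] is nonnegative, so the sum drops strictly at each descent. *)
have [N] := ubnP (\sum_i `|(c i + 1)%R|)%N; elim: N c => // N IH c cN vc Uc.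
have [cmin|/existsNP [e]] := pselect (forall e, valid e -> vle e c -> U e -> e = c).
  by exists c; split=> // i.
move=> /not_implyP [ve /not_implyP [ec /not_implyP [Ue nec]]].
have [|d [vd Ud de dmin]] := IH e _ ve Ue; last first.
  by exists d; split=> // i; apply: le_trans (de i) (ec i).
have [i nei] : exists i, e i <> c i.
  apply: contrapT => h; apply/nec/ffunP => i; apply: contrapT => hi.
  by apply: h; exists i.
rewrite -ltnS; apply: leq_trans cN; rewrite !ltnS (bigD1 i) //= [in leqRHS](bigD1 i) //= -addSn.
apply: leq_add; last apply: leq_sum => j _.
  by move: (ve i) (vc i) (ec i); lia.
by move: (ve j) (vc j) (ec j); lia.
Qed.

Lemma adiff_ge0 a b i : 0 <= adiff a b i -> 0 <= b i /\ adiff a b i = a i + 1 - b i.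
Proof. by rewrite ffunE; case: ifP. Qed.

Lemma adiffE a b i : 0 <= b i -> adiff a b i = a i + 1 - b i.
Proof. by rewrite ffunE => ->. Qed.

End Vectors.

(** * The dual and the double dual *)

Section Duality.
Variables (k : fieldType) (sig : {rmorphism k -> k}) (n : nat).
Variables (I : dpoly k n -> Prop) (a : evec n).
Hypotheses (idI : is_sigma_ideal sig I) (radI : is_radical I).
Hypotheses (wmI : well_mixed sig I) (monI : is_monomial_ideal I).
Hypotheses (va : valid a) (Ia : forall b, charvec I b -> vle b a).
Implicit Types (b c d e : evec n) (p : dpoly k n).
Local Notation D := (alex_dual sig I a).

Lemma mem_ymonE p : I p <-> forall m, m \in msupp p -> I (ymon k (mvec m)).
Proof.
rewrite (monomial_idealE monI); split=> h m /h.
  by move/(monomialE idI radI wmI).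
by move=> hm; apply/(monomialE idI radI wmI).
Qed.

Lemma mem_charvecE c : valid c ->
  I (ymon k c) <-> exists2 b, charvec I b & vle b c.
Proof.
move=> vc; split=> [Ic|[b [vb Ib _] bc]].
  have [d [vd Id dc dmin]] := exists_minimal_vec (U := fun e => I (ymon k e)) vc Ic.
  by exists d.
by apply: (ymon_le idI radI wmI _ Ib) => i _; exact: bc.
Qed.

Lemma dual_ymonE c :
  D (ymon k c) <-> forall b, charvec I b -> exists i, 0 <= b i /\ a i + 1 - b i <= c i.
Proof.
split=> h b Ib; have ba := Ia Ib.
  have /mideal_ymon [i /andP [/adiff_ge0 [b0 ->] le]] := h b Ib; by exists i.
apply/mideal_ymon; have [i [b0 le]] := h b Ib; exists i; rewrite adiffE //.
(* From [b i <= a i], the entry of [adiff a b] is nonnegative and so gives a generator. *)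
by rewrite le andbT; move: (ba i); lia.
Qed.

(** No threshold [a i + 1 - b i] with [0 <= b i] exceeds [a i + 1], so a larger entry could be
    lowered to it. This bound keeps [a i + 1 - d i] nonnegative. *)
Lemma dual_charvec_le d : charvec D d -> forall i, d i <= a i + 1.
Proof.
move=> [vd /dual_ymonE Dd dmin] i; rewrite leNgt; apply/negP => lt.
pose d' : evec n := [ffun j => if j == i then a i + 1 else d j].
have /(congr1 (fun e : evec n => e i)) : d' = d.
  apply: dmin.
  - by move=> j; rewrite ffunE; case: eqP => // _; move: (va i); lia.
  - by move=> j; rewrite ffunE; case: eqP => // ->; apply: ltW.
  apply/dual_ymonE => b Ib; have [j [b0 le]] := Dd b Ib; exists j; split=> //.
  by rewrite ffunE; case: eqP => // e; subst j; lia.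
by rewrite ffunE eqxx; lia.
Qed.

Lemma mem_dual_ymonE c : valid c ->
  I (ymon k c) <-> forall d, charvec D d -> mideal sig (adiff a d) (ymon k c).
Proof.
move=> vc; split=> [/(mem_charvecE vc) [b Ib bc] d Dd|h].
  have [_ /dual_ymonE /(_ b Ib) [i [b0 le]] _] := Dd.
  apply/mideal_ymon; exists i.
  (* The same index serves: [a i + 1 - b i <= d i] gives [a i + 1 - d i <= b i <= c i]. *)
  by move: (dual_charvec_le Dd i) (Ia Ib i) (bc i) => *; rewrite adiffE; lia.
apply/(mem_charvecE vc); apply: contrapT => nI.
(* [d] is the largest vector with [y^(x^c)] not in [m^(a\d)]. *)
pose d : evec n := [ffun i => Num.max (-1) (a i - c i)].
have vd : valid d by move=> i; rewrite ffunE; lia.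
have Dd : D (ymon k d).
  apply/dual_ymonE => b Ib.
  have [i lt] : exists i, c i < b i.
    apply: contrapT => nlt; apply: nI; exists b => // i.
    by rewrite leNgt; apply/negP => lt; apply: nlt; exists i.
  by exists i; rewrite ffunE; move: (vc i) (Ia Ib i); lia.
have [d' [vd' Dd' dd' dmin]] := exists_minimal_vec (U := fun e => D (ymon k e)) vd Dd.
(* Where [0 <= d' i], also [d' i <= a i - c i], so [a i + 1 - d' i] exceeds [c i]. *)
have /mideal_ymon [i /andP [/adiff_ge0 [d0 ->]]] := h d' (And3 vd' Dd' dmin).
by move: (dd' i); rewrite ffunE; lia.
Qed.

Lemma eq_dual_dual :
  eqR I (fun p => forall d, charvec D d -> mideal sig (adiff a d) p).
Proof.
move=> p; rewrite mem_ymonE; split=> h.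
  move=> d Dd; apply/midealE => m /h /(mem_dual_ymonE (mvec_valid m)) /(_ d Dd).
  by move/mideal_ymon.
move=> m mp; apply/(mem_dual_ymonE (mvec_valid m)) => d /h /midealE /(_ m mp) hm.
exact/mideal_ymon.
Qed.

(* The [m^b] containing [I] with [b <= a] suffice; [box] contains all such [b]. *)
Lemma exists_decomposition :
  exists2 bs : seq (evec n), (forall b, b \in bs -> valid b) & eqR I (mcap sig bs).
Proof.
(* Entries are stored shifted by one, with [0] standing for -1; [N] leaves room for all entries up
   to [a i]. *)
pose N := \max_i `|(a i + 2)%R|%N.
pose vec (f : {ffun 'I_n -> 'I_N.+1}) : evec n := [ffun i => (f i : nat)%:Z - 1].
pose box := [seq vec f | f in {ffun 'I_n -> 'I_N.+1}].
pose bs := [seq b <- box | `[< subR I (mideal sig b) >]].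
exists bs => [b|p].
  by rewrite mem_filter => /andP [_ /mapP [f _ ->]] i; rewrite ffunE; lia.
split=> [Ip b|h]; first by rewrite mem_filter => /andP [/asboolP + _]; apply.
apply/mem_ymonE => m mp; have vc := mvec_valid m; set c := mvec m in vc *.
apply/(mem_charvecE vc); apply: contrapT => nI.
(* This [m^b] omits [y^(x^c)]. It contains [I]: a character vector [e] has [c i < e i <= a i] for
   some [i], where [b i = c i + 1]. *)
pose b : evec n := [ffun i => if c i < a i then c i + 1 else -1].
have /midealE /(_ m mp) [i] : mideal sig b p; last first.
  by rewrite -/c ffunE; case: ifP => _; lia.
apply: h; rewrite mem_filter; apply/andP; split; last first.
  pose f : {ffun 'I_n -> 'I_N.+1} := [ffun i => inord `|(b i + 1)%R|%N].
  apply/mapP; exists f; first by rewrite mem_enum.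
  apply/ffunP => i; rewrite [RHS]ffunE (ffunE _ i : f i = _) inordK.
    by rewrite ffunE; case: ifP => _; move: (vc i); lia.
  rewrite ltnS; apply: leq_trans (leq_bigmax i).
  by rewrite ffunE; move: (vc i) (va i); case: ifP; lia.
apply/asboolP => q /mem_ymonE hq; apply/midealE => m' /hq.
case/(mem_charvecE (mvec_valid m')) => e Ie le.
have [i lt] : exists i, c i < e i.
  apply: contrapT => nlt; apply: nI; exists e => // i.
  by rewrite leNgt; apply/negP => lt; apply: nlt; exists i.
exists i; rewrite ffunE; move: (vc i) (le i) (Ia Ie i) => ? ? ?.
by case: ifP; lia.
Qed.

(** * Irreducible components and generators of the dual *)

Lemma exists_irredundant : exists bs : seq (evec n),
  [/\ forall b, b \in bs -> valid b, uniq bs, eqR I (mcap sig bs) &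
      forall b, b \in bs -> ~ eqR I (mcap sig (rem b bs))].
Proof.
have [bs vbs Ibs] := exists_decomposition.
(* Induction on the length: duplicates are removed first, then any redundant member. *)
have [N] := ubnP (size bs); elim: N bs vbs Ibs => // N IH bs vbs Ibs bsN.
have [ubs|nubs] := boolP (uniq bs); last first.
  apply: (IH (undup bs)).
  - by move=> b; rewrite mem_undup; apply: vbs.
  - by move=> p; rewrite Ibs; split=> h b bb; apply: h; rewrite mem_undup in bb *.
  - by move: bsN; rewrite ltnS; apply: leq_trans; rewrite ltn_size_undup.
have [irr|/existsNP [b /not_implyP [bb /contrapT Ib]]] :=
  pselect (forall b, b \in bs -> ~ eqR I (mcap sig (rem b bs))).
  by exists bs.
apply: (IH (rem b bs)) => //; first by move=> c /mem_rem; apply: vbs.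
by rewrite size_rem //; move: bsN; case: (bs) bb.
Qed.

(** For a character vector [c], [y^(x^c)] lies in [m^b], so [0 <= b i <= c i] for some [i];
    reflection in [a] reverses this inequality. *)
Lemma dual_irr_component b : irr_component sig I b -> D (ymon k (adiff a b)).
Proof.
move=> [bs [_ _ Ibs _ bb]] c Ic; have [vc /Ibs /(_ b bb)] := Ic.
move/mideal_ymon => [i /andP [b0 bc]] _.
apply/mideal_ymon; exists i; rewrite !adiffE //; last exact: le_trans bc.
by move: (Ia Ic i); lia.
Qed.

(** If every component failed, the reflection [c] of [e] would lie in the up-set of [I], and a
    character vector below [c] would contradict membership of [y^(x^e)] in the dual. *)
Lemma dual_ge_irr_component e : valid e -> D (ymon k e) ->
  exists2 b, irr_component sig I b & forall i, 0 <= b i -> adiff a b i <= e i.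
Proof.
move=> ve /dual_ymonE De; have [bs [vbs ubs Ibs irr]] := exists_irredundant.
apply: contrapT => nb.
pose M := \sum_(b <- bs) \sum_i `|b i|%N.
have leM b i : b \in bs -> b i <= M%:Z.
  move=> bb; rewrite /M (big_rem b) //= (bigD1 i) //=; lia.
(* Where [e i = -1], the entry [M] dominates all components; no threshold [a i + 1 - b i >= 1] is
   met there. *)
pose c : evec n := [ffun i => if 0 <= e i then Num.max (-1) (a i - e i) else M%:Z].
have vc : valid c by move=> i; rewrite ffunE; case: ifP; lia.
have : I (ymon k c).
  apply/Ibs => b bb; apply/mideal_ymon.
  have [i [b0 lt]] : exists i, 0 <= b i /\ e i < adiff a b i.
    apply: contrapT => h; apply: nb; exists b; first by exists bs.
    by move=> i b0; rewrite leNgt; apply/negP => lt; apply: h; exists i.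
  exists i; rewrite ffunE b0; move: lt (leM b i bb); rewrite adiffE //.
  by case: ifP; lia.
case/(mem_charvecE vc) => b Ib bc; have [i [b0 le]] := De b Ib.
by move: (bc i) (Ia Ib i); rewrite ffunE; case: ifP; lia.
Qed.

Lemma dual_eq_closure :
  eqR D (rwm_closure sig (fun p =>
    exists2 b, irr_component sig I b & p = ymon k (adiff a b))).
Proof.
move=> p; split=> [Dp J idJ radJ wmJ genJ|cp].
  rewrite (monalgE p) big_seq; have [[J0 JD JM] _] := idJ.
  apply: (big_ind J) => [||m mp]; [exact: J0 | exact: JD |].
  rewrite -[X in << _ *g X >>]mulm1 malgUM; apply/JM/(monomialE idJ radJ wmJ).
  (* Some generator has its vector below [mvec m] at its nonnegative entries. *)
  have [|b Ib le] := @dual_ge_irr_component (mvec m) (mvec_valid m).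
    move=> c Ic; apply/mideal_ymon.
    by have /midealE /(_ m mp) := Dp c Ic.
  apply: (ymon_le idJ radJ wmJ _ (genJ _ (ex_intro2 _ _ b Ib erefl))).
  by move=> i /adiff_ge0 [b0 _]; apply: le.
(* The dual inherits all closure properties from the [m^(a\b)] it intersects. *)
apply: (cp D).
- split; first split.
  + by move=> b _; case: (mideal_sigma_ideal sig (adiff a b)) => -[].
  + move=> q r Dq Dr b Ib; case: (mideal_sigma_ideal sig (adiff a b)) => -[_ + _] _.
    by apply; [apply: Dq | apply: Dr].
  + move=> q r Dr b Ib; case: (mideal_sigma_ideal sig (adiff a b)) => -[_ _ +] _.
    by apply; apply: Dr.
  + by move=> q Dq b Ib; apply: (mideal_sigma_ideal sig _).2; apply: Dq.
- by move=> q m Dq b Ib; apply: mideal_radical (Dq b Ib).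
- by move=> q r Dqr b Ib; apply: mideal_well_mixed (Dqr b Ib).
- by move=> _ [b Ib ->]; apply: dual_irr_component.
Qed.

End Duality.

Theorem theorem7p4 (k : fieldType) (sig : {rmorphism k -> k}) (n : nat)
    (I : dpoly k n -> Prop) (a : evec n) :
  [pchar k] =i pred0 ->
  is_sigma_ideal sig I -> is_radical I -> well_mixed sig I ->
  is_monomial_ideal I ->
  valid a -> (forall b, charvec I b -> vle b a) ->
  eqR I (fun x => forall b, charvec (alex_dual sig I a) b ->
                            mideal sig (adiff a b) x)
  /\
  eqR (alex_dual sig I a)
      (rwm_closure sig (fun p => exists2 b, irr_component sig I b &
                                             p = ymon k (adiff a b))).
Proof.
move=> _ idI radI wmI monI va Ia; split; first exact: eq_dual_dual.
exact: dual_eq_closure.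
Qed.
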